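(* Let $q\in\widetilde{\mathbb C}$ and $\mu\in\mathbb C$ with $\mu\neq0$ and $\mu\neq q^{-n}$ for all $n\ge0$. Let $u$ be the symmetrical form such that $\sigma u=\mathcal U(\mu,q)$. Then $u$ is $H_{\sqrt q}$-semiclassical of class one and satisfies $$H_{\sqrt q}\big(x(x^2-\mu^{-1}q^{-1})u\big)-\big(\mu q(\sqrt q-1)\big)^{-1}\big\{(\mu q-1)x^2-1\big\}u=0 .$$ Its recurrence coefficients are, for $n\ge0$, $$\gamma_{2n+1}=-q^{2n}\frac{1-\mu q^n}{(1-\mu q^{2n})(1-\mu q^{2n+1})},\qquad \gamma_{2n+2}=q^n\frac{1-q^{n+1}}{(1-\mu q^{2n+1})(1-\mu q^{2n+2})} ,$$ and its moments are $$(u)_{2n}=\frac{(-1)^nq^{\frac12n(n-1)}}{(\mu q;q)_n},\qquad (u)_{2n+1}=0,\qquad n\ge0 .$$ Moreover, if $q>1$ and $\mu<0$, then $$u=\frac{1}{(\mu^{-1}q^{-1};q^{-1})_\infty}\sum_{k=0}^\infty\frac{(-\mu^{-1})^kq^{-\frac12k(k+1)}}{(q^{-1};q^{-1})_k}\,\frac{\delta_{-i\sqrt{-\mu^{-1}}\,q^{-\frac{k+1}2}}+\delta_{i\sqrt{-\mu^{-1}}\,q^{-\frac{k+1}2}}}{2} .$$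
   Context: $\mathcal P$ is the vector space of polynomials in one variable with complex coefficients and $\mathcal P'$ its dual; elements of $\mathcal P'$ are called forms; $\langle u,f\rangle$ is the action of $u$ on $f$ and $(u)_n=\langle u,x^n\rangle$ are the moments. All regular forms are normalized by $(u)_0=1$. A form is symmetrical if $(u)_{2n+1}=0$ for all $n\ge0$. Let $\widetilde{\mathbb C}=\{z\in\mathbb C: z\neq0,\ z^n\neq1\ \forall n\ge1\}$; $\sqrt{\cdot}$ is the principal square root. $(a;q)_0=1$, $(a;q)_n=\prod_{k=1}^n(1-aq^{k-1})$, and $(a;q)_\infty=\prod_{k\ge0}(1-aq^k)$ for $|q|<1$. $\delta_c$ is the form $\langle\delta_c,f\rangle=f(c)$; equalities with series of forms mean equality (with convergence) when applied to every polynomial. For a polynomial $g$, $\langle gu,f\rangle=\langle u,gf\rangle$. For $r\in\widetilde{\mathbb C}$, $(H_rf)(x)=\frac{f(rx)-f(x)}{(r-1)x}$ and $\langle H_ru,f\rangle=-\langle u,H_rf\rangle$. The form $\sigma u$ is defined by $\langle\sigma u,f\rangle=\langle u,f(x^2)\rangle$. A form $u$ is regular if there is a sequence of monic polynomials $\{B_n\}_{n\ge0}$, $\deg B_n=n$, with $\langle u,B_mB_n\rangle=r_n\delta_{n,m}$, $r_n\ne0$; then $B_0=1$, $B_1=x-\beta_0$, $B_{n+2}=(x-\beta_{n+1})B_{n+1}-\gamma_{n+1}B_n$ with $\gamma_{n+1}\neq0$, $n\ge0$ (for symmetrical $u$ all $\beta_n=0$); the $\gamma_{n+1}$ are the recurrence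 coefficients. A form $u$ is $H_r$-semiclassical if it is regular and $H_r(\Phi u)+\Psi u=0$ for some polynomials $\Phi$ (monic, degree $t\ge0$) and $\Psi$ (degree $p\ge1$). It is of class $s=\max(p-1,t-2)$ if the pair $(\Phi,\Psi)$ satisfies $$\prod_{c\in\mathcal Z_\Phi}\Big\{\big|r\Psi(rc)+(H_r\Phi)(c)\big|+\big|\langle u,\ r(\theta_{cr}\Psi)+\theta_{cr}(\theta_c\Phi)\rangle\big|\Big\}>0,$$ where $\mathcal Z_\Phi$ is the set of zeros of $\Phi$ and $(\theta_cf)(x)=\frac{f(x)-f(c)}{x-c}$. $\mathcal U(\mu,q)$ (the $q$-Charlier-II form) is the form with $(\mathcal U(\mu,q))_0=1$ satisfying $H_q\big(x(x-\mu^{-1}q^{-1})\mathcal U(\mu,q)\big)-\big(\mu q(q-1)\big)^{-1}\big((\mu q-1)x-1\big)\mathcal U(\mu,q)=0$. *)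

(* Defs.v *)
From HB Require Import structures.
From mathcomp Require Import all_boot all_order all_algebra.
From mathcomp Require Import complex.
From mathcomp Require Import all_classical all_reals all_analysis.

Set Implicit Arguments.
Unset Strict Implicit.
Unset Printing Implicit Defensive.

Import Order.TTheory GRing.Theory Num.Theory.
Import numFieldNormedType.Exports.

Local Open Scope ring_scope.
Local Open Scope classical_set_scope.

Notation polyform K := {scalar {poly K}}.

Section Forms.
Variable K : numClosedFieldType.
Implicit Types (u w : polyform K) (f g Phi Psi : {poly K}) (r c a q : K).

Definition moment u (n : nat) : K := u 'X^n.

Definition symmetrical u : Prop := forall n, moment u n.*2.+1 = 0.

(* The quotients below are exact: the remainder of each division is zero
   (for [Hpoly], as soon as [r != 1]). *)
Definition theta c f : {poly K} := (f - f.[c]%:P) %/ ('X - c%:P).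

Definition Hpoly r f : {poly K} :=
  (f \Po (r *: 'X) - f) %/ ((r - 1) *: 'X).

Lemma Hpoly_linear r : linear (Hpoly r).
Proof.
move=> a f g; rewrite /Hpoly linearP /=.
rewrite opprD addrACA -scalerBr.
by rewrite Pdiv.Field.divpD Pdiv.Field.divpZl.
Qed.

Definition mulform g u (f : {poly K}) : K := u (g * f).

Lemma mulform_linear g u : linear_for *%R (mulform g u).
Proof. by move=> a f h; rewrite /mulform mulrDr -scalerAr linearP. Qed.

HB.instance Definition _ g u :=
  GRing.isLinear.Build K {poly K} K *%R (mulform g u) (mulform_linear g u).

Definition Hform r u (f : {poly K}) : K := - u (Hpoly r f).

Lemma Hform_linear r u : linear_for *%R (Hform r u).
Proof.
by move=> a f h; rewrite /Hform Hpoly_linear linearP opprD mulrN.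
Qed.

HB.instance Definition _ r u :=
  GRing.isLinear.Build K {poly K} K *%R (Hform r u) (Hform_linear r u).

Definition sigma u (f : {poly K}) : K := u (f \Po 'X^2).

Lemma sigma_linear u : linear_for *%R (sigma u).
Proof. by move=> a f h; rewrite /sigma !linearP. Qed.

HB.instance Definition _ u :=
  GRing.isLinear.Build K {poly K} K *%R (sigma u) (sigma_linear u).

Definition dirac_form c : polyform K := horner_eval c.

(* [H_r (Phi u) + Psi u = 0] *)
Definition H_equation r Phi Psi u : Prop :=
  Hform r (mulform Phi u) \+ mulform Psi u =1 \0.

Definition monic_orthogonal u (B : nat -> {poly K}) : Prop :=
  (forall n, B n \is monic /\ size (B n) = n.+1) /\
  exists rho : nat -> K, (forall n, rho n != 0) /\
    forall m n, u (B m * B n) = if n == m then rho n else 0.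

Definition regular u : Prop := exists B, monic_orthogonal u B.

(* The values [gamma n.+1] are the recurrence coefficients; [gamma 0] plays
   no role. *)
Definition recurrence_coefficients u (beta gamma : nat -> K) : Prop :=
  exists B : nat -> {poly K},
    [/\ monic_orthogonal u B,
        B 0%N = 1,
        B 1%N = 'X - (beta 0%N)%:P,
        forall n, gamma n.+1 != 0
      & forall n, B n.+2 =
          ('X - (beta n.+1)%:P) * B n.+1 - gamma n.+1 *: B n].

Definition class_condition r Phi Psi u : Prop :=
  forall c, root Phi c ->
    0 < `| r * Psi.[r * c] + (Hpoly r Phi).[c] |
        + `| u (r *: theta (c * r) Psi + theta (c * r) (theta c Phi)) |.

(* With [t = (size Phi).-1] and [p = (size Psi).-1 >= 1], truncated
   subtraction does not alter [max (p - 1) (t - 2)]. *)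
Definition semiclassical_of_class r u (s : nat) : Prop :=
  regular u /\
  exists Phi Psi : {poly K},
    [/\ Phi \is monic,
        (2 <= size Psi)%N,
        H_equation r Phi Psi u,
        s = maxn ((size Psi).-1 - 1) ((size Phi).-1 - 2)
      & class_condition r Phi Psi u].

Definition Ctilde q : Prop := q != 0 /\ forall n, (1 <= n)%N -> q ^+ n != 1.

Definition qpoch a q (n : nat) : K := \prod_(1 <= k < n.+1) (1 - a * q ^+ k.-1).

(* Meaningful when [`|q| < 1], where the products converge. *)
Definition qpoch_oo a q : K := limn (qpoch a q).

(* [w] is the q-Charlier-II form U(mu, q). *)
Definition qCharlierII (mu q : K) w : Prop :=
  moment w 0 = 1 /\
  H_equation q ('X * ('X - (mu^-1 * q^-1)%:P))
    (- ((mu * q * (q - 1))^-1 *: ((mu * q - 1) *: 'X - 1))) w.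

(* [u = c * \sum_k a_k v_k], tested on every polynomial, with convergence. *)
Definition form_eq_series u c (a : nat -> K) (v : nat -> {poly K} -> K) : Prop :=
  forall f, cvgn (series (fun k => a k * v k f)) /\
    u f = c * limn (series (fun k => a k * v k f)).

End Forms.

(* Principal square root: [sqrtc] has nonnegative real part, and is in
   ['i * R_+] on the negative reals, whereas [sqrtC] is the root with
   nonnegative imaginary part. *)
Definition psqrt (R : realType) (z : R[i]) : R[i] := sqrtc z.

(* Main.v *)
Require Import Defs.
From mathcomp Require Import all_boot all_order all_algebra.
From mathcomp Require Import complex.
From mathcomp Require Import all_classical all_reals all_analysis.
From mathcomp Require Import ring.

Set Implicit Arguments.
Unset Strict Implicit.
Unset Printing Implicit Defensive.

Import Order.TTheory GRing.Theory Num.Theory.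
Local Open Scope ring_scope.

(** A linear form is determined by its moments, and everything is read off
    them.

    Tested on [x^n], the q-difference equation of U(mu, q) becomes a recurrence
    of order one, [(1 - mu q^(n+1)) m_(n+1) = - q^n m_n], so the moments are
    products ([qCharlierII_moment_rec], [qCharlierII_momentE]).  The even moments
    of [u] are those of U(mu, q) and the odd ones vanish; with [r^2 = q] the same
    recurrence is the H_r-equation of [u] tested on even monomials, while both
    sides vanish on odd ones ([symmetrized_H_equation]).  The degrees 3 and 2 of
    Phi and Psi give the class 1, and at each zero of Phi the first of the two
    absolute values in the class condition is already nonzero
    ([symmetrized_class_condition]).

    For the recurrence coefficients, let [B_n] be the monic polynomials generated
    by the announced gamma.  The numbers [u(x^k B_n)] satisfy
    [M(n+2, k) = M(n+1, k+1) - gamma_(n+1) M(n, k)], and their solution is a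
    closed product ([mixed_moments]).  Such a formula exists because the
    underlying basic hypergeometric sum is summable by q-Chu-Vandermonde; the
    proof merely checks the recurrence.  The product contains the factor
    [prod_(i < h) (q^i - q^j)] with [h = n/2] and [j = k/2], which vanishes
    exactly when [j < h], so the [B_n] are orthogonal
    ([symmetrized_orthogonal]).

    For the series put [p = 1/q] in ]0, 1[ and [z = -1/(mu q) > 0].  Euler's sum
    [F(z) = sum_k p^(k(k-1)/2) z^k / (p; p)_k] satisfies [F(z) = (1 + z) F(p z)]
    and [F(p^n z)] tends to 1, whence [F(z) = prod_(i >= 0) (1 + z p^i)]
    ([euler_prod_cvg]).  Tested on [x^(2j)], the series of Dirac forms is
    [(mu q)^(-j) F(p^j z)], and dividing by [F(z)] leaves
    [(mu q)^(-j) / prod_(i < j) (1 + z p^i)], the moment of order [2j]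
    ([qCharlierII_momentV], [symmetrized_series]). *)

(** * Forms tested on monomials *)

Section Algebra.
Variable K : numClosedFieldType.
Implicit Types (u w : polyform K) (f g : {poly K}) (r q mu : K).

Lemma form_coefE u f : u f = \sum_(i < size f) f`_i * u 'X^i.
Proof.
rewrite -[in LHS](coefK f) poly_def linear_sum.
by apply: eq_bigr => i _; rewrite linearZ.
Qed.

Lemma Hpoly_Xn r n : r != 1 ->
  Hpoly r 'X^n = ((r ^+ n - 1) / (r - 1)) *: 'X^(n.-1).
Proof.
move=> r1; have r10 : r - 1 != 0 by rewrite subr_eq0.
rewrite /Hpoly comp_Xn_poly exprZn.
case: n => [|n] /=; first by rewrite !expr0 scale1r !subrr div0p mul0r scale0r.
have -> : r ^+ n.+1 *: 'X^(n.+1) - 'X^(n.+1) =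
   (((r ^+ n.+1 - 1) / (r - 1)) *: 'X^n) * ((r - 1) *: 'X) :> {poly K}.
  by rewrite -scalerAl -scalerAr scalerA divfK // -exprSr scalerBl scale1r.
by rewrite mulpK // scaler_eq0 negb_or r10 polyX_eq0.
Qed.

(** Both sides are linear in the test polynomial, so the equation may be tested
    on monomials, where the operator acts by [Hpoly_Xn]. *)
Lemma H_equation_Xn r Phi Psi u :
  (forall n, u (Psi * 'X^n) = u (Phi * Hpoly r 'X^n)) <-> H_equation r Phi Psi u.
Proof.
split=> [e f | e n]; last first.
  have /= := e 'X^n; rewrite /Hform /mulform => /eqP.
  by rewrite addrC subr_eq0 => /eqP.
pose w : polyform K := (Hform r (mulform Phi u) \+ mulform Psi u)%R.
rewrite -[LHS]/(w f) form_coefE big1 // => i _.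
by rewrite /w /= /Hform /mulform e addNr mulr0.
Qed.

(** Expanding the polynomial of lower degree in monomials, only its leading term
    survives; hence orthogonality to powers of [x] suffices. *)
Lemma Xn_orthogonal u (B : nat -> {poly K}) :
  (forall n, B n \is monic /\ size (B n) = n.+1) ->
  (forall k n, (k < n)%N -> u ('X^k * B n) = 0) ->
  (forall n, u ('X^n * B n) != 0) -> monic_orthogonal u B.
Proof.
move=> mB z nz.
have key m n : (m <= n)%N ->
    u (B m * B n) = if n == m then u ('X^n * B n) else 0.
  move=> mn; have [lm sm] := mB m.
  rewrite -[B m in LHS]coefK poly_def mulr_suml linear_sum sm big_ord_recr /=.
  rewrite big1 ?add0r => [|i _]; last first.
    by rewrite -scalerAl linearZ /= z ?mulr0 // (leq_trans (ltn_ord i)).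
  move: lm; rewrite monicE lead_coefE sm => /eqP ->; rewrite scale1r.
  case: eqP => [-> //| /eqP nm]; apply: z; by rewrite ltn_neqAle eq_sym nm.
split=> //; exists (fun n => u ('X^n * B n)); split=> // m n.
case: (leqP m n) => [/key //|nm]; rewrite mulrC key 1?ltnW //.
by rewrite eq_sym; case: eqP => // ->.
Qed.

(** * Polynomials generated by a symmetric recurrence *)

(** As in a recurrence without diagonal coefficients, [gamma n.+1] is the
    coefficient that produces the polynomial of degree [n.+2]. *)
Fixpoint symmetric_OP (gamma : nat -> K) (n : nat) : {poly K} :=
  match n with
  | 0 => 1
  | n'.+1 => match n' with
             | 0 => 'X
             | n''.+1 => 'X * symmetric_OP gamma n' -
                         gamma n' *: symmetric_OP gamma n''
             end
  end.

Lemma symmetric_OPSS gamma n : symmetric_OP gamma n.+2 =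
  'X * symmetric_OP gamma n.+1 - gamma n.+1 *: symmetric_OP gamma n.
Proof. by []. Qed.

Lemma symmetric_OP_monic gamma n :
  symmetric_OP gamma n \is monic /\ size (symmetric_OP gamma n) = n.+1.
Proof.
set B := symmetric_OP gamma.
suff : (B n \is monic /\ size (B n) = n.+1) /\
       (B n.+1 \is monic /\ size (B n.+1) = n.+2) by case.
elim: n => [|n [[m0 s0] [m1 s1]]].
  by rewrite /B /= monic1 size_poly1 monicX size_polyX.
split=> //; rewrite /B symmetric_OPSS -/B.
have sX : size ('X * B n.+1) = n.+3 by rewrite mulrC size_mulX ?s1 ?monic_neq0.
have lt : (size (- (gamma n.+1 *: B n))%R < size ('X * B n.+1)%R)%N.
  by rewrite size_polyN sX (leq_ltn_trans (size_scale_leq _ _)) // s0.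
rewrite size_polyDl // sX monicE lead_coefDl // [_ * B _]mulrC lead_coefMX.
by rewrite -monicE.
Qed.

(** The polynomial of degree [n] has the parity of [n]; the product with [x^k] is
    then odd, and a symmetrical form kills it. *)
Lemma symmetric_OP_parity u gamma k n :
  symmetrical u -> odd (k + n) -> u ('X^k * symmetric_OP gamma n) = 0.
Proof.
move=> su; set B := symmetric_OP gamma.
have sodd j : odd j -> u 'X^j = 0.
  by move=> oj; rewrite -[j]odd_double_half oj add1n; exact: su.
suff : forall k, (odd (k + n) -> u ('X^k * B n) = 0) /\
       (odd (k + n.+1) -> u ('X^k * B n.+1) = 0) by move=> /(_ k)[].
elim: n {k} => [|n IHn] k.
  by rewrite /B /= mulr1 addn0 addn1 -exprSr; split => /sodd.
split; first exact: (IHn k).2.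
move=> okn; rewrite /B symmetric_OPSS -/B mulrBr -scalerAr linearB linearZ /=.
rewrite mulrA -exprSr (IHn k.+1).2 ?(IHn k).1 ?mulr0 ?subr0 //.
- by move: okn; rewrite !addnS /= negbK.
- by move: okn; rewrite !addnS.
Qed.

(** * Moments of the q-Charlier-II form *)

Lemma qpochS a q n : qpoch a q n.+1 = qpoch a q n * (1 - a * q ^+ n).
Proof. by rewrite /qpoch big_nat_recr. Qed.

Lemma qpoch0 a q : qpoch a q 0 = 1.
Proof. by rewrite /qpoch big_nil. Qed.

Section QCharlier.
Variables (q mu : K).
Hypotheses (hq : Ctilde q) (hmu0 : mu != 0)
  (hmu : forall n : nat, mu != q ^- n).

Let q0 : q != 0. Proof. by case: hq. Qed.

Lemma Ctilde_expB1 n : 1 - q ^+ n.+1 != 0.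
Proof. by case: hq => _ /(_ n.+1 isT); rewrite subr_eq0 eq_sym. Qed.

Lemma one_sub_mu_neq0 n : 1 - mu * q ^+ n != 0.
Proof.
apply: contraNneq (hmu n) => /eqP; rewrite subr_eq0 eq_sym => /eqP e.
by apply/eqP; apply: (mulIf (expf_neq0 n q0)); rewrite e mulVf ?expf_neq0.
Qed.

Lemma qpoch_mu_neq0 n : qpoch (mu * q) q n != 0.
Proof.
elim: n => [|n IHn]; first by rewrite qpoch0 oner_neq0.
by rewrite qpochS mulf_neq0 // -mulrA -exprS one_sub_mu_neq0.
Qed.

(** The equation tested on [x^n] involves only [x^n] and [x^(n+1)], because the
    factor [x] of Phi compensates the degree lost by the q-derivative. *)
Lemma qCharlierII_moment_rec (U : polyform K) n : qCharlierII mu q U ->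
  (1 - mu * q ^+ n.+1) * moment U n.+1 = - q ^+ n * moment U n.
Proof.
case=> U0 /H_equation_Xn /(_ n); rewrite /moment.
have q1' : q != 1 by case: hq => _ /(_ 1%N isT).
have q1 : q - 1 != 0 by rewrite subr_eq0.
have -> : - ((mu * q * (q - 1))^-1 *: ((mu * q - 1) *: 'X - 1)) * 'X^n =
   (mu * q * (q - 1))^-1 *: ((1 - mu * q) *: 'X^(n.+1) + 'X^n) :> {poly K}.
  rewrite mulNr -scalerAl mulrBl -scalerAl mul1r -exprS -scalerN opprB.
  by congr (_ *: _); rewrite -[1 - _ * _]opprB scaleNr addrC.
rewrite linearZ linearD linearZ Hpoly_Xn // -scalerAr linearZ /=.
have -> : (q ^+ n - 1) / (q - 1) *
    U ('X * ('X - (mu^-1 * q^-1)%:P) * 'X^(n.-1)) =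
    (q ^+ n - 1) / (q - 1) * (U 'X^(n.+1) - mu^-1 * q^-1 * U 'X^n).
  case: n => [|n] /=; first by rewrite expr0 subrr !mul0r.
  have -> a : 'X * ('X - a%:P) * 'X^n = 'X^(n.+2) - a *: 'X^(n.+1) :> {poly K}.
    by rewrite -mul_polyC !exprS; ring.
  by rewrite linearB linearZ.
move=> e.
have e' : (1 - mu * q) * U 'X^(n.+1) + U 'X^n =
    (q ^+ n - 1) * (mu * q * U 'X^(n.+1) - U 'X^n).
  apply: (mulfI (x := (mu * q * (q - 1))^-1)).
    by rewrite invr_eq0 !mulf_neq0.
  by rewrite e; field; rewrite q1 hmu0 q0.
apply/eqP; rewrite -subr_eq0; apply/eqP; rewrite exprS.
transitivity ((1 - mu * q) * U 'X^(n.+1) + U 'X^n -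
    (q ^+ n - 1) * (mu * q * U 'X^(n.+1) - U 'X^n)); first by ring.
by rewrite e' subrr.
Qed.

Definition qCharlierII_moment n : K :=
  (-1) ^+ n * q ^+ (n * (n - 1))./2 / qpoch (mu * q) q n.

Lemma qCharlierII_momentE (U : polyform K) n :
  qCharlierII mu q U -> moment U n = qCharlierII_moment n.
Proof.
rewrite /qCharlierII_moment subn1 -bin2 => hU; elim: n => [|n IHn].
  by case: hU => -> _; rewrite qpoch0 !expr0 mulr1 divr1.
apply: (mulfI (one_sub_mu_neq0 n.+1)); rewrite qCharlierII_moment_rec // IHn.
rewrite qpochS binS bin1 addnC exprD !exprS.
have := qpoch_mu_neq0 n; have := one_sub_mu_neq0 n.+1; rewrite exprS.
by move=> a b; field; rewrite -mulrA a b.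
Qed.

(** * Recurrence coefficients and orthogonality *)

Definition symmetrized_gamma (n : nat) : K :=
  if n is n'.+1 then
    let m := n'./2 in
    if odd n' then
      q ^+ m * ((1 - q ^+ m.+1) /
        ((1 - mu * q ^+ m.*2.+1) * (1 - mu * q ^+ m.*2.+2)))
    else
      - q ^+ m.*2 * ((1 - mu * q ^+ m) /
        ((1 - mu * q ^+ m.*2) * (1 - mu * q ^+ m.*2.+1)))
  else 0.

Arguments symmetrized_gamma n : simpl never.

Lemma symmetrized_gamma_odd n : symmetrized_gamma n.*2.+1 =
  - q ^+ n.*2 * ((1 - mu * q ^+ n) /
    ((1 - mu * q ^+ n.*2) * (1 - mu * q ^+ n.*2.+1))).
Proof. by rewrite /symmetrized_gamma odd_double doubleK. Qed.

Lemma symmetrized_gamma_even n : symmetrized_gamma n.*2.+2 =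
  q ^+ n * ((1 - q ^+ n.+1) /
    ((1 - mu * q ^+ n.*2.+1) * (1 - mu * q ^+ n.*2.+2))).
Proof. by rewrite /symmetrized_gamma /= odd_double /= uphalf_double. Qed.

Lemma symmetrized_gamma_neq0 n : symmetrized_gamma n.+1 != 0.
Proof.
rewrite -[n]odd_double_half; case: (odd n); rewrite ?add1n ?add0n.
  by rewrite symmetrized_gamma_even !mulf_neq0 ?invr_eq0 ?mulf_neq0 ?expf_neq0
    ?Ctilde_expB1 ?one_sub_mu_neq0.
by rewrite symmetrized_gamma_odd !mulf_neq0 ?oppr_eq0 ?invr_eq0 ?mulf_neq0 ?expf_neq0
    ?one_sub_mu_neq0.
Qed.

(** The zeros [k = 0, ..., n - 1] of this factor are the source of
    orthogonality. *)
Definition qgap n k : K := \prod_(i < n) (q ^+ i - q ^+ k).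

(** The normalization of the mixed moments that does not depend on [k]; the
    recurrence from [B_(2n+1)], [B_(2n)] to [B_(2n+2)] forces it, as the value of
    that recurrence at [q^k = 0]. *)
Definition amplitude n : K := \prod_(i < n) (- symmetrized_gamma i.*2.+1 / q ^+ i).

Lemma qgapS n k : qgap n.+1 k = qgap n k * (q ^+ n - q ^+ k).
Proof. by rewrite /qgap big_ord_recr. Qed.

Lemma qgapSS n k : qgap n.+1 k.+1 = q ^+ n * (1 - q ^+ k.+1) * qgap n k.
Proof.
rewrite /qgap; elim: n => [|n IHn]; first by rewrite big_ord1 big_ord0 mulr1 mul1r.
by rewrite big_ord_recr IHn [in RHS]big_ord_recr /= !exprS; ring.
Qed.

Lemma qgap0 n k : (k < n)%N -> qgap n k = 0.
Proof. by move=> kn; rewrite /qgap (bigD1 (Ordinal kn)) //= subrr mul0r. Qed.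

Lemma qgap_neq0 n : qgap n n != 0.
Proof.
apply/prodf_neq0 => i _.
rewrite -[in q ^+ n](subnKC (ltn_ord i)) addSnnS exprD -[X in X - _]mulr1.
by rewrite -mulrBr mulf_neq0 ?expf_neq0 ?Ctilde_expB1.
Qed.

Lemma amplitudeS n : amplitude n.+1 = amplitude n * (- symmetrized_gamma n.*2.+1 / q ^+ n).
Proof. by rewrite /amplitude big_ord_recr. Qed.

Lemma amplitude_neq0 n : amplitude n != 0.
Proof.
apply/prodf_neq0 => i _; rewrite mulf_neq0 ?invr_eq0 ?expf_neq0 //.
by rewrite oppr_eq0 symmetrized_gamma_neq0.
Qed.

Section Orthogonality.
Variable u : polyform K.
Hypothesis u_even : forall n, u 'X^(n.*2) = qCharlierII_moment n.

Let B := symmetric_OP symmetrized_gamma.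

(** Induction on [n]: the step from degree [2n + 1] to [2n + 2] uses gamma of odd
    index, the step from [2n + 2] to [2n + 3] gamma of even index.  After removal
    of the common factors, either step is an identity between polynomials of
    degree one in [q^k]. *)
Lemma mixed_moments n :
  (forall k, u ('X^(k.*2) * B n.*2) = amplitude n * qgap n k *
     ((-1) ^+ k * q ^+ 'C(k, 2)) / qpoch (mu * q) q (k + n)) /\
  (forall k, u ('X^(k.*2.+1) * B n.*2.+1) =
     amplitude n.+1 * (1 - mu * q ^+ n.*2.+1) * qgap n k *
     ((-1) ^+ k.+1 * q ^+ 'C(k.+1, 2)) / qpoch (mu * q) q (k + n).+1).
Proof.
elim: n => [|n [IHa IHc]].
  split=> k; rewrite /amplitude /qgap ?big_ord1 !big_ord0 /B /= addn0.
    by rewrite mulr1 u_even /qCharlierII_moment subn1 -bin2 !mul1r.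
  rewrite -exprSr -doubleS u_even /qCharlierII_moment subn1 -bin2.
  rewrite symmetrized_gamma_odd /= double0 !expr0 !expr1 !mulr1.
  have := one_sub_mu_neq0 0; have := one_sub_mu_neq0 1.
  rewrite expr0 expr1 mulr1 => h1 h0.
  have := qpoch_mu_neq0 k.+1 => h2.
  by field; rewrite h0 h1 h2.
(* All powers become monomials in q, q^n and q^k, as field requires. *)
have q2 m : q ^+ m.*2 = q ^+ m ^+ 2 by rewrite -muln2 exprM.
have a1 k : u ('X^(k.*2) * B n.+1.*2) = amplitude n.+1 * qgap n.+1 k *
     ((-1) ^+ k * q ^+ 'C(k, 2)) / qpoch (mu * q) q (k + n.+1).
  rewrite doubleS /B symmetric_OPSS -/B mulrBr linearB mulrA -exprSr.
  rewrite -scalerAr linearZ /= IHa IHc !addnS qpochS qgapS amplitudeS symmetrized_gamma_odd.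
  have := one_sub_mu_neq0 n; have := one_sub_mu_neq0 n.*2.
  have := one_sub_mu_neq0 n.*2.+1; have := qpoch_mu_neq0 (k + n).
  have := one_sub_mu_neq0 (k + n).+1.
  rewrite binS bin1 addnC !exprD !exprS !q2 exprD.
  set qn := q ^+ n; set qk := q ^+ k; set D := qpoch _ _ _.
  move=> h1 h2 h3 h4 h5.
  have qn0 : qn != 0 by rewrite expf_neq0.
  by field; do ?[apply/andP; split]; rewrite -?mulrA.
split=> // k.
rewrite [in B _]doubleS /B symmetric_OPSS -/B -doubleS mulrBr linearB mulrA -exprSr.
rewrite -doubleS -scalerAr linearZ /= a1 IHc qgapSS qgapS.
rewrite (amplitudeS n.+1) (symmetrized_gamma_even n) (symmetrized_gamma_odd n.+1).
rewrite addSn !addnS !qpochS.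
have := one_sub_mu_neq0 n.+1; have := one_sub_mu_neq0 n.+1.*2.
have := one_sub_mu_neq0 n.+1.*2.+1; have := qpoch_mu_neq0 (k + n).
have := one_sub_mu_neq0 (k + n).+1; have := one_sub_mu_neq0 (k + n).+2.
have := one_sub_mu_neq0 n.*2.+1; have := amplitude_neq0 n.+1.
rewrite !doubleS !exprS !q2 !exprD.
set qn := q ^+ n; set qk := q ^+ k; set D := qpoch _ _ _.
move=> h0 h1 h2 h3 h4 h5 h6 h7.
have qn0 : qn != 0 by rewrite expf_neq0.
by field; do ?[apply/andP; split]; rewrite -?mulrA.
Qed.

Hypothesis u_sym : symmetrical u.

Lemma symmetrized_orthogonal : monic_orthogonal u B.
Proof.
apply: Xn_orthogonal => [n|k n kn|n]; first exact: symmetric_OP_monic.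
- have [odd_kn|even_kn] := boolP (odd (k + n)); first exact: symmetric_OP_parity.
  have ekn : odd k = odd n by move: even_kn; rewrite oddD; do 2!case: odd.
  move: kn; rewrite -[k]odd_double_half -[n]odd_double_half ekn.
  rewrite ltn_add2l ltn_double => kn.
  have [a c] := mixed_moments n./2; case: (odd n); rewrite ?add0n ?add1n.
    by rewrite c qgap0 // !(mulr0, mul0r).
  by rewrite a qgap0 // !(mulr0, mul0r).
- rewrite -[n]odd_double_half; have [a c] := mixed_moments n./2.
  by case: (odd n); rewrite ?add0n ?add1n ?a ?c !mulf_neq0 ?invr_eq0
    ?qpoch_mu_neq0 ?one_sub_mu_neq0 ?qgap_neq0 ?amplitude_neq0 ?expf_neq0 ?oppr_eq0
    ?oner_neq0.
Qed.

Lemma symmetrized_recurrence : recurrence_coefficients u (fun=> 0) symmetrized_gamma.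
Proof.
exists B; split=> //; first exact: symmetrized_orthogonal.
- by rewrite subr0.
- exact: symmetrized_gamma_neq0.
- by move=> n; rewrite subr0.
Qed.

Lemma symmetrized_regular : regular u.
Proof. by exists B; exact: symmetrized_orthogonal. Qed.

End Orthogonality.

(** * The H_r-equation of the symmetrized form and its class *)

Section Symmetrization.
Variables (u : polyform K) (r : K).
Hypothesis r2 : r ^+ 2 = q.

Let a : K := mu^-1 * q^-1.
Let Phi : {poly K} := 'X * ('X^2 - a%:P).
Let Psi : {poly K} :=
  - ((mu * q * (r - 1))^-1 *: ((mu * q - 1) *: 'X^2 - 1)).

Let r_neq1 : r != 1.
Proof.
case: hq => _ /(_ 1%N isT); apply: contraNneq => r1.
by rewrite expr1 -r2 r1 expr1n.
Qed.

Let r0 : r != 0.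
Proof. by apply: contraNneq q0 => r0; rewrite -r2 r0 expr0n. Qed.

Let rB1 : r - 1 != 0. Proof. by rewrite subr_eq0. Qed.

(** On [x^(2k)] the H_r-derivative produces [r^(2k) - 1 = q^k - 1], so the
    equation is the one of U(mu, q) tested on [x^k]. *)
Lemma symmetrized_H_equation (U : polyform K) :
  qCharlierII mu q U -> symmetrical u -> sigma u =1 U ->
  H_equation r Phi Psi u.
Proof.
move=> hU u_sym sU; apply/H_equation_Xn => n.
have u_even k : u 'X^(k.*2) = moment U k.
  by rewrite /moment -sU /= /sigma comp_Xn_poly -exprM mul2n.
have key : (1 - mu * q) * u 'X^(n.+2) + u 'X^n =
    (r ^+ n - 1) * (mu * q * u 'X^(n.+2) - u 'X^n).
  rewrite -[n]odd_double_half; case: (odd n); rewrite ?add1n ?add0n.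
    have o k : u 'X^(k.*2.+1) = 0 by exact: u_sym.
    by rewrite -doubleS !o !mulr0 subr0 mulr0 addr0.
  rewrite -doubleS !u_even; have := qCharlierII_moment_rec n./2 hU.
  rewrite -muln2 mulnC exprM r2 exprS => e.
  apply/eqP; rewrite -subr_eq0; apply/eqP.
  transitivity ((1 - mu * (q * q ^+ n./2)) * moment U n./2.+1 -
    - q ^+ n./2 * moment U n./2); first by ring.
  by rewrite e subrr.
have -> : Psi * 'X^n =
   (mu * q * (r - 1))^-1 *: ((1 - mu * q) *: 'X^(n.+2) + 'X^n).
  rewrite /Psi mulNr -scalerAl mulrBl -scalerAl mul1r -exprD -scalerN opprB.
  by congr (_ *: _); rewrite -[1 - _ * _]opprB scaleNr addrC.
rewrite linearZ linearD linearZ Hpoly_Xn // -scalerAr linearZ /= key.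
have -> : (r ^+ n - 1) / (r - 1) * u (Phi * 'X^(n.-1)) =
    (r ^+ n - 1) / (r - 1) * (u 'X^(n.+2) - a * u 'X^n).
  case: n {key} => [|n] /=; first by rewrite expr0 subrr !mul0r.
  have -> : Phi * 'X^n = 'X^(n.+3) - a *: 'X^(n.+1).
    by rewrite /Phi -mul_polyC !exprS; ring.
  by rewrite linearB linearZ.
by rewrite /a; field; rewrite rB1 hmu0 q0.
Qed.

Let muq0 : mu * q != 0. Proof. by rewrite mulf_neq0. Qed.

Let Phi_monic : Phi \is monic.
Proof. by rewrite monicMl ?monicX // monicXnsubC. Qed.

Let size_Phi : size Phi = 4.
Proof. by rewrite /Phi mulrC size_mulX ?size_XnsubC // monic_neq0 ?monicXnsubC. Qed.

Let size_Psi : size Psi = 3.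
Proof.
rewrite size_polyN size_scale ?invr_eq0 ?mulf_neq0 //.
have h : mu * q - 1 != 0.
  by have := one_sub_mu_neq0 1; rewrite expr1 !subr_eq0 eq_sym.
rewrite size_polyDl ?size_scale ?size_polyXn //.
by rewrite size_polyN size_poly1.
Qed.

(** The quantity [r Psi(r c) + (H_r Phi)(c)] equals [1 / (mu q (r - 1))] at
    [c = 0] and [r / (mu^2 q (r - 1))] at the zeros with [c^2 = 1 / (mu q)]. *)
Lemma symmetrized_class_condition : class_condition r Phi Psi u.
Proof.
move=> c /rootP; rewrite /Phi hornerM hornerX hornerD hornerN hornerC hornerXn.
move=> /eqP Phi_c; apply: ltr_wpDr; first exact: normr_ge0.
rewrite normr_gt0.
have -> : Hpoly r Phi = (- a)%:P + (r ^+ 2 + r + 1) *: 'X^2.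
  have -> : Phi = - a *: 'X^1 + 'X^3 by rewrite /Phi -mul_polyC polyCN !exprS; ring.
  rewrite Hpoly_linear !Hpoly_Xn // expr1 divff // scale1r /= expr0 alg_polyC.
  by congr (_ + _ *: _); field.
have -> : Psi.[r * c] = (mu * q * (r - 1))^-1 * ((1 - mu * q) * (r * c) ^+ 2 + 1).
  rewrite /Psi hornerN hornerZ hornerD hornerZ hornerXn hornerN -polyC1 hornerC.
  by ring.
rewrite hornerD hornerC hornerZ hornerXn.
move: Phi_c; rewrite mulf_eq0 => /orP[/eqP -> | ]; last first.
  rewrite subr_eq0 => /eqP c2.
  have -> : r * ((mu * q * (r - 1))^-1 * ((1 - mu * q) * (r * c) ^+ 2 + 1)) +
     (- a + (r ^+ 2 + r + 1) * c ^+ 2) = r / (mu * (mu * q * (r - 1))).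
    by rewrite exprMn c2 /a -r2; field; rewrite rB1 hmu0 r0.
  by rewrite mulf_neq0 ?invr_eq0 ?mulf_neq0.
have -> : r * ((mu * q * (r - 1))^-1 * ((1 - mu * q) * (r * 0) ^+ 2 + 1)) +
     (- a + (r ^+ 2 + r + 1) * 0 ^+ 2) = (mu * q * (r - 1))^-1.
  by rewrite /a; field; rewrite rB1 hmu0 q0.
by rewrite invr_eq0 mulf_neq0.
Qed.

Lemma symmetrized_class_one : regular u -> H_equation r Phi Psi u ->
  semiclassical_of_class r u 1.
Proof.
move=> reg eqn; split=> //; exists Phi, Psi; rewrite size_Phi size_Psi.
by split=> //; exact: symmetrized_class_condition.
Qed.

End Symmetrization.

End QCharlier.

End Algebra.

(** * Euler's q-exponential sum *)

Section Analysis.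
Import numFieldNormedType.Exports.
Local Open Scope classical_set_scope.
Local Open Scope ring_scope.

Section Euler.
Variables (R : realType) (p : R).
Hypotheses (p0 : 0 < p) (p1 : p < 1).
Implicit Types z : R.

Definition euler_term z k : R :=
  p ^+ 'C(k, 2) * z ^+ k / \prod_(i < k) (1 - p ^+ i.+1).

Let pB1 : 0 < 1 - p. Proof. by rewrite subr_gt0. Qed.

Let pX_lt1 k : p ^+ k.+1 < 1. Proof. by rewrite exprn_ilt1 // ltW. Qed.

Let pXB1 k : 0 < 1 - p ^+ k.+1. Proof. by rewrite subr_gt0. Qed.

Lemma euler_term0 z : euler_term z 0 = 1.
Proof. by rewrite /euler_term big_ord0 !expr0 mulr1 divr1. Qed.

Lemma euler_termS z k :
  euler_term z k.+1 = euler_term z k * (p ^+ k * z / (1 - p ^+ k.+1)).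
Proof.
rewrite /euler_term big_ord_recr binS bin1 exprD [z ^+ _]exprS /=.
have h : \prod_(i < k) (1 - p ^+ i.+1) != 0.
  by apply/prodf_neq0 => i _; rewrite gt_eqF.
by field; rewrite h gt_eqF.
Qed.

Let pX_ge0 k : 0 <= p ^+ k. Proof. by rewrite exprn_ge0 // ltW. Qed.

Let ratio_ge0 z k : 0 <= z -> 0 <= p ^+ k * z / (1 - p ^+ k.+1).
Proof. by move=> z0; rewrite divr_ge0 ?mulr_ge0 // ltW. Qed.

Lemma euler_term_ge0 z k : 0 <= z -> 0 <= euler_term z k.
Proof.
move=> z0; elim: k => [|k IHk]; first by rewrite euler_term0 ler01.
by rewrite euler_termS mulr_ge0 ?ratio_ge0.
Qed.

(** Since [p^k <= 1] and [1 - p^(k+1) >= 1 - p], the ratio of consecutive terms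
    is at most [z / (1 - p)]. *)
Lemma euler_term_le_geometric z k : 0 <= z ->
  euler_term z k <= geometric 1 (z / (1 - p)) k.
Proof.
move=> z0; rewrite /geometric /= mul1r.
elim: k => [|k IHk]; first by rewrite euler_term0.
rewrite euler_termS [leRHS]exprSr ler_pM ?euler_term_ge0 ?ratio_ge0 //.
have pX_le1 m : p ^+ m <= 1 by rewrite exprn_ile1 // ltW.
apply: ler_pM; rewrite ?mulr_ge0 ?invr_ge0 ?ler_piMl //; first exact: ltW.
by rewrite lef_pV2 ?posrE // lerD2l lerN2 exprS ler_piMr // ltW.
Qed.

Lemma euler_term_dilate z k : euler_term (p * z) k = p ^+ k * euler_term z k.
Proof. by rewrite /euler_term exprMn; ring. Qed.

(** The functional equation [F(z) = F(p z) + z F(p z)], exact at the level of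
    partial sums. *)
Lemma euler_series_dilate z n :
  series (euler_term z) n.+1 =
  series (euler_term (p * z)) n.+1 + z * series (euler_term (p * z)) n.
Proof.
elim: n => [|n IHn].
  by rewrite /series /= !big_nat1 big_geq // mulr0 addr0 !euler_term0.
rewrite [LHS]seriesSr IHn [in RHS]seriesSr (seriesSr _ n).
rewrite !euler_term_dilate euler_termS.
by field; rewrite gt_eqF.
Qed.

Lemma euler_series_small z : 0 <= z -> z < 1 - p ->
  cvgn (series (euler_term z)) /\
  limn (series (euler_term z)) <= (1 - z / (1 - p))^-1.
Proof.
move=> z0 z1; set g := geometric 1 (z / (1 - p)).
have g1 : `|z / (1 - p)| < 1.
  by rewrite ger0_norm ?divr_ge0 ?(ltW pB1) // ltr_pdivrMr // mul1r.
have cg : cvgn (series g) by exact: is_cvg_geometric_series.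
have ct : cvgn (series (euler_term z)).
  apply: series_le_cvg cg => n; first exact: euler_term_ge0.
    by rewrite /g /geometric /= mul1r exprn_ge0 // divr_ge0 // ltW.
  exact: euler_term_le_geometric.
split=> //; rewrite -[leRHS]mul1r -(cvg_lim _ (@cvg_geometric_series _ 1 _ g1)) //.
by apply: lim_series_le => // n; exact: euler_term_le_geometric.
Qed.

Lemma expr_dilate_small z : \forall N \near \oo, p ^+ N * z < 1 - p.
Proof.
have : (p ^+ N * z @[N --> \oo] --> 0 * z)%classic.
  by apply: cvgMr_tmp; apply: cvg_expr; rewrite ger0_norm ?ltW.
rewrite mul0r => /cvgrPdist_lt /(_ _ pB1); apply: filterS => N.
by rewrite sub0r normrN; apply: le_lt_trans; exact: ler_norm.
Qed.

Lemma euler_series_dilate_cvg z l :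
  (series (euler_term (p * z)) @ \oo --> l)%classic ->
  (series (euler_term z) @ \oo --> (1 + z) * l)%classic.
Proof.
move=> h; rewrite -cvg_shiftS; under eq_fun do rewrite euler_series_dilate.
rewrite mulrDl mul1r; apply: cvgD; first by rewrite (cvg_shiftS (series _)).
exact: cvgMl_tmp.
Qed.

(** Dilating [z] by [p] finitely often brings it into the range where the series
    is dominated by a geometric one, and the functional equation carries
    convergence back. *)
Lemma euler_series_cvg z : 0 <= z -> cvgn (series (euler_term z)).
Proof.
move=> z0; have [N _ /(_ N (leqnn N)) /=] := expr_dilate_small z.
elim: N z z0 => [|N IHN] z z0; first by rewrite mul1r => /euler_series_small[].
rewrite exprSr -mulrA => /IHN; rewrite mulr_ge0 ?(ltW p0) // => /(_ isT) c.
by apply/cvg_ex; eexists; apply: euler_series_dilate_cvg; exact: c.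
Qed.

Definition euler_sum z : R := limn (series (euler_term z)).

Definition euler_prod z n : R := \prod_(i < n) (1 + z * p ^+ i).

Lemma euler_prod_gt0 z n : 0 <= z -> 0 < euler_prod z n.
Proof.
move=> z0; apply: prodr_gt0 => i _.
by rewrite ltr_pwDl // mulr_ge0.
Qed.

Lemma euler_sum_dilate z n : 0 <= z ->
  euler_sum z = euler_prod z n * euler_sum (p ^+ n * z).
Proof.
move=> z0; elim: n => [|n ->].
  by rewrite /euler_prod big_ord0 !mul1r.
rewrite /euler_prod big_ord_recr /= -mulrA; congr (_ * _).
rewrite exprS -mulrA [z * _]mulrC; apply: cvg_lim => //.
apply: euler_series_dilate_cvg; apply: euler_series_cvg.
by rewrite !mulr_ge0 // ltW.
Qed.

Lemma euler_sum_ge1 z : 0 <= z -> 1 <= euler_sum z.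
Proof.
move=> z0; apply: limr_ge; first exact: euler_series_cvg.
near=> n; have -> : n = n.-1.+1 by rewrite prednK //; near: n; exact: nbhs_infty_gt.
rewrite /series /= big_nat_recl // euler_term0 lerDl.
by apply: sumr_ge0 => i _; exact: euler_term_ge0.
Unshelve. all: by end_near. Qed.

(** Squeezed between the first term of the series and its geometric majorant. *)
Lemma euler_sum_dilate_cvg z : 0 <= z ->
  (euler_sum (p ^+ n * z) @[n --> \oo] --> (1 : R))%classic.
Proof.
move=> z0.
apply: (@squeeze_cvgr _ _ _ _ (fun=> 1) (fun n => (1 - p ^+ n * z / (1 - p))^-1)).
- near=> n; have pz : 0 <= p ^+ n * z by rewrite mulr_ge0.
  rewrite euler_sum_ge1 //=; apply: (euler_series_small _ _).2 => //.
  by near: n; exact: expr_dilate_small.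
- exact: cvg_cst.
have pN : p ^+ N @[N --> \oo] --> (0 : R).
  by apply: cvg_expr; rewrite ger0_norm ?ltW.
have lim1 : 1 - p ^+ N * z / (1 - p) @[N --> \oo] --> 1 - 0 * z / (1 - p).
  exact: (cvgB (cvg_cst (1 : R)) (cvgMr_tmp (cvgMr_tmp pN))).
have e1 : 1 - 0 * z / (1 - p) = 1 by rewrite !mul0r subr0.
by have := cvgV _ lim1; rewrite e1 invr1; apply; exact: oner_neq0.
Unshelve. all: by end_near. Qed.

Lemma euler_prod_cvg z : 0 <= z ->
  (euler_prod z @ \oo --> euler_sum z)%classic.
Proof.
move=> z0.
have -> : euler_prod z = fun n => euler_sum z / euler_sum (p ^+ n * z).
  apply/funext => n; rewrite (euler_sum_dilate n z0) mulfK // gt_eqF //.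
  by apply: lt_le_trans (euler_sum_ge1 _); rewrite ?mulr_ge0.
rewrite -[X in (_ --> X)%classic]divr1; apply: cvgMl_tmp.
by apply: cvgV; [exact: oner_neq0 | exact: euler_sum_dilate_cvg].
Qed.

End Euler.

(** * Series of forms over the complex numbers *)

Section Embed.
Variable R : realType.
Local Open Scope complex_scope.
(* Naming the structure lets the topology of the complex numbers be inferred. *)
Let C : numClosedFieldType := R[i].

Lemma cvg_real_complex (f : nat -> R) (l : R) :
  f @ \oo --> l -> (fun n => (f n)%:C : C) @ \oo --> (l%:C : C).
Proof.
move=> /cvgrPdist_le fl; apply/cvgrPdist_le => e e0.
have [re ime] : 0 < complex.Re e /\ e = (complex.Re e)%:C.
  by move: e0; case: e => a b; rewrite ltcE /= => /andP[/eqP -> ->].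
apply: filterS (fl _ re) => n.
by rewrite -rmorphB /= normc_def /= expr0n addr0 sqrtr_sqr ime lecR.
Qed.

End Embed.

(** A polynomial test function is a finite combination of monomials, so
    convergence on monomials suffices. *)
Lemma form_eq_series_Xn (K : numClosedFieldType) (u : polyform K) (l : K) a
    (v : nat -> {poly K} -> K) : l != 0 ->
  (forall k f, v k f = \sum_(i < size f) f`_i * v k 'X^i) ->
  (forall n, series (fun k => a k * v k 'X^n) @ \oo --> l * u 'X^n) ->
  form_eq_series u l^-1 a v.
Proof.
move=> l0 vE cvgX f.
have h : series (fun k => a k * v k f) @ \oo --> l * u f.
  have -> : series (fun k => a k * v k f) =
      fun N => \sum_(i < size f) f`_i * series (fun k => a k * v k 'X^i) N.
    apply/funext => N; rewrite /series /=.
    under eq_bigr do rewrite vE mulr_sumr.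
    rewrite exchange_big /=; apply: eq_bigr => i _; rewrite mulr_sumr.
    by apply: eq_bigr => k _; rewrite mulrCA.
  rewrite form_coefE mulr_sumr; under eq_bigr do rewrite mulrCA.
  apply: cvg_big => [|i _]; first exact: add_continuous.
  by apply: cvgMl_tmp; exact: cvgX.
split; first by apply/cvg_ex; exists (l * u f).
by rewrite (cvg_lim _ h) ?mulKf //; exact: norm_hausdorff.
Qed.

(** Reversal [q -> 1/q] of the product formula, through
    [1 - mu q^k = - mu q^k (1 - mu^-1 q^-k)]; the base of modulus less than one
    is the one of the infinite product. *)
Lemma qCharlierII_momentV (K : numClosedFieldType) (q mu : K) n :
  Ctilde q -> mu != 0 -> (forall n, mu != q ^- n) ->
  qCharlierII_moment q mu n =
  (mu^-1 * q^-1) ^+ n / qpoch (mu^-1 * q^-1) q^-1 n.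
Proof.
move=> hq mu0 hmu; have q0 : q != 0 by case: hq.
have f0 k : 1 - mu^-1 * q^-1 * q^-1 ^+ k = - (1 - mu * q ^+ k.+1) / (mu * q ^+ k.+1).
  by rewrite exprS exprVn; field; rewrite q0 mu0 expf_neq0.
have nz k : qpoch (mu^-1 * q^-1) q^-1 k != 0.
  elim: k => [|k IHk]; first by rewrite qpoch0 oner_neq0.
  rewrite qpochS mulf_neq0 // f0 mulf_neq0 ?invr_eq0 ?mulf_neq0 ?expf_neq0 //.
  by rewrite oppr_eq0 one_sub_mu_neq0.
rewrite /qCharlierII_moment subn1 -bin2; elim: n => [|n IHn].
  by rewrite !qpoch0 !expr0 mul1r.
rewrite binS bin1 exprD !qpochS exprSr [in RHS]exprSr f0.
transitivity ((-1) ^+ n * q ^+ 'C(n, 2) / qpoch (mu * q) q n *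
    (- q ^+ n / (1 - mu * q ^+ n.+1))).
  have := one_sub_mu_neq0 hq hmu n.+1; rewrite !exprS => h.
  by field; rewrite h qpoch_mu_neq0.
have := one_sub_mu_neq0 hq hmu n.+1; rewrite IHn !exprS => h.
by field; rewrite expf_neq0 // q0 mu0 h nz.
Qed.

Lemma dirac_formE (K : numClosedFieldType) (c : K) f : dirac_form c f = f.[c].
Proof. by []. Qed.

Section Series.
Variable R : realType.
Let C : numClosedFieldType := R[i].
Local Open Scope complex_scope.

Lemma qpoch_real_complex (a b : R) n :
  qpoch (a%:C : C) b%:C n = (\prod_(i < n) (1 - a * b ^+ i))%:C.
Proof.
elim: n => [|n IHn]; first by rewrite qpoch0 big_ord0.
by rewrite qpochS IHn big_ord_recr /= rmorphM rmorphB rmorphM rmorphXn rmorph1.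
Qed.

Lemma euler_term_complex (p y : R) k : (euler_term p y k)%:C =
  (p%:C : C) ^+ 'C(k, 2) * (y%:C : C) ^+ k / qpoch (p%:C : C) p%:C k.
Proof.
rewrite qpoch_real_complex /euler_term.
rewrite !rmorphM fmorphV !rmorphXn; congr (_ / _); congr (_%:C).
by apply: eq_bigr => i _; rewrite exprS.
Qed.

(* Only the squares of the square roots s of -1/mu and r of q enter: the points
   of mass come in pairs x, -x. *)
Variables (p m : R) (q mu s r : C).
Hypotheses (p0 : 0 < p) (p1 : p < 1) (m0 : m < 0).
Hypotheses (qV : q^-1 = p%:C) (muV : mu^-1 = m%:C).
Hypotheses (s2 : s ^+ 2 = - mu^-1) (r2 : r ^+ 2 = q).
Let z : R := - (m * p).

Let z_ge0 : 0 <= z.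
Proof. by rewrite oppr_ge0 mulr_le0_ge0 // ltW. Qed.

Let qpoch_prod n : qpoch (mu^-1 * q^-1) q^-1 n = (euler_prod p z n)%:C.
Proof.
rewrite qV muV -rmorphM qpoch_real_complex; congr (_%:C).
by apply: eq_bigr => i _; rewrite /z mulNr.
Qed.

Let qpoch_oo_sum : qpoch_oo (mu^-1 * q^-1) q^-1 = (euler_sum p z)%:C.
Proof.
apply: cvg_lim; first exact: norm_hausdorff.
rewrite (_ : qpoch _ _ = fun n => (euler_prod p z n)%:C); last exact/funext.
exact: (cvg_real_complex (euler_prod_cvg p0 p1 z_ge0)).
Qed.

(** On [x^(2j)] the mass at the k-th pair of points contributes the factor
    [(mu^-1 q^-(k+1))^j], which turns the series into Euler's sum at [p^j z]. *)
Lemma symmetrized_series (u : polyform C) :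
  Ctilde q -> mu != 0 -> (forall n, mu != q ^- n) ->
  (forall n, u 'X^(n.*2) = qCharlierII_moment q mu n) -> symmetrical u ->
  form_eq_series u (qpoch_oo (mu^-1 * q^-1) q^-1)^-1
    (fun k => (- mu^-1) ^+ k * q ^- (k * k.+1)./2 / qpoch q^-1 q^-1 k)
    (fun k f =>
       let x := 'i%R * s * r ^- k.+1 in
       (dirac_form (- x) f + dirac_form x f) / 2).
Proof.
move=> hq mu0 hmu u_even u_sym.
have F0 : (euler_sum p z)%:C != 0 :> C.
  by rewrite fmorph_eq0 gt_eqF // (lt_le_trans ltr01) ?euler_sum_ge1.
apply: form_eq_series_Xn => [|k f|j]; first by rewrite qpoch_oo_sum.
  cbv zeta; rewrite !dirac_formE.
  rewrite !horner_coef -big_split mulr_suml; apply: eq_bigr => i _ /=.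
  by rewrite !dirac_formE !hornerXn; ring.
set t := fun k => _.
have x2 k : ('i%R * s * r ^- k.+1) ^+ 2 = mu^-1 * q^-1 ^+ k.+1.
  by rewrite !exprMn sqrCi s2 mulrNN mul1r -!exprVn -!exprM mulnC exprM (exprVn r 2) r2.
have t_odd k : odd j -> t k = 0.
  move=> oj; rewrite /t !dirac_formE !hornerXn (exprNn _ j) -signr_odd oj.
  by rewrite expr1 mulN1r addNr mul0r mulr0.
have t_even k : ~~ odd j ->
    t k = (mu^-1 * q^-1) ^+ j./2 * (euler_term p (p ^+ j./2 * z) k)%:C.
  move=> ej; rewrite /t !dirac_formE !hornerXn (exprNn _ j) -signr_odd (negbTE ej).
  rewrite expr0 mul1r -{1 2}[j]odd_double_half (negbTE ej) add0n.
  have zC : (p ^+ j./2 * z)%:C = - (q^-1 ^+ j./2 * (mu^-1 * q^-1)) :> C.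
    by rewrite /z mulrN rmorphN !rmorphM rmorphXn qV muV.
  rewrite -mul2n !exprM x2 euler_term_complex zC -qV.
  rewrite mulnC -[(k.+1 * k)%N]/(k.+1 * k.+1.-1)%N -bin2 binS bin1.
  rewrite -exprVn exprD !exprS -mulrN -mulNr !exprMn -!exprM [(k * _)%N]mulnC.
  set D := (qpoch _ _ _)^-1; set Q := q^-1; set M := mu^-1.
  by field.
rewrite -[j]odd_double_half; have [odd_j|even_j] := boolP (odd j).
  have -> : u 'X^(1 + j./2.*2) = 0 by exact: u_sym.
  rewrite mulr0 (_ : series t = fun=> 0); first exact: cvg_cst.
  by apply/funext => N; rewrite /series /= big1 // => k _; exact: t_odd.
rewrite add0n u_even qCharlierII_momentV // qpoch_prod qpoch_oo_sum.
set c := (mu^-1 * q^-1) ^+ j./2.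
have -> : series t =
    fun N => c * (series (euler_term p (p ^+ j./2 * z)) N)%:C.
  apply/funext => N; rewrite /series /= rmorph_sum mulr_sumr.
  by apply: eq_bigr => k _; exact: t_even.
have -> : (euler_sum p z)%:C * (c / (euler_prod p z j./2)%:C) =
    c * (euler_sum p (p ^+ j./2 * z))%:C.
  rewrite [X in X%:C * _](euler_sum_dilate p0 p1 j./2 z_ge0) rmorphM; field.
  by rewrite fmorph_eq0 gt_eqF ?euler_prod_gt0.
apply: cvgMl_tmp; apply: cvg_real_complex; apply: euler_series_cvg => //.
by rewrite mulr_ge0 ?exprn_ge0 ?(ltW p0).
Qed.

End Series.

End Analysis.

Theorem mainTheorem8 (R : realType) (q mu : R[i]) (U u : polyform R[i])
    (hq : Ctilde q) (hmu0 : mu != 0) (hmu : forall n : nat, mu != q ^- n)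
    (hU : qCharlierII mu q U) (hsym : symmetrical u) (hu : sigma u =1 U) :
  [/\ semiclassical_of_class (psqrt q) u 1,
      H_equation (psqrt q) ('X * ('X^2 - (mu^-1 * q^-1)%:P))
        (- ((mu * q * (psqrt q - 1))^-1 *: ((mu * q - 1) *: 'X^2 - 1))) u,
      exists gamma : nat -> R[i],
        recurrence_coefficients u (fun=> 0) gamma /\
        forall n : nat,
          gamma (2 * n + 1)%N =
            - q ^+ (2 * n) * ((1 - mu * q ^+ n) /
               ((1 - mu * q ^+ (2 * n)) * (1 - mu * q ^+ (2 * n + 1)))) /\
          gamma (2 * n + 2)%N =
            q ^+ n * ((1 - q ^+ n.+1) /
               ((1 - mu * q ^+ (2 * n + 1)) * (1 - mu * q ^+ (2 * n + 2)))),
      forall n : nat,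
        moment u (2 * n) =
          (-1) ^+ n * q ^+ (n * (n - 1))./2 / qpoch (mu * q) q n /\
        moment u (2 * n + 1) = 0
    & 1 < q -> mu < 0 ->
        form_eq_series u (qpoch_oo (mu^-1 * q^-1) q^-1)^-1
          (fun k => (- mu^-1) ^+ k * q ^- (k * k.+1)./2 / qpoch q^-1 q^-1 k)
          (fun k f =>
             let x := 'i * psqrt (- mu^-1) * psqrt q ^- k.+1 in
             (dirac_form (- x) f + dirac_form x f) / 2) ].
Proof.
have r2 : psqrt q ^+ 2 = q by exact: sqr_sqrtc.
have u_even n : u 'X^(n.*2) = qCharlierII_moment q mu n.
  rewrite -(qCharlierII_momentE hq hmu0 hmu n hU) /moment -hu /= /sigma comp_Xn_poly.
  by rewrite -exprM mul2n.
have eqn := symmetrized_H_equation hq hmu0 r2 hU hsym hu.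
split=> //.
- apply: (symmetrized_class_one hq hmu0 hmu r2) => //.
  exact: (symmetrized_regular hq hmu u_even hsym).
- exists (symmetrized_gamma q mu); split; first exact: symmetrized_recurrence.
  by move=> n; rewrite mul2n addn1 addn2 symmetrized_gamma_odd symmetrized_gamma_even.
- move=> n; rewrite mul2n addn1; split; first exact: u_even.
  exact: hsym.
move=> q1 mu0.
have q_real : q = (complex.Re q)%:C%C.
  by move: q1; case: (q) => a b; rewrite ltcE /= => /andP[/eqP -> _].
have mu_real : mu = (complex.Re mu)%:C%C.
  by move: mu0; case: (mu) => a b; rewrite ltcE /= => /andP[/eqP <- _].
have rq1 : 1 < complex.Re q by rewrite -ltcR -q_real.
have rmu0 : complex.Re mu < 0 by rewrite -ltcR -mu_real.
apply: (@symmetrized_series R (complex.Re q)^-1 (complex.Re mu)^-1) => //.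
- by rewrite invr_gt0 (lt_trans ltr01).
- by rewrite invf_lt1 // (lt_trans ltr01).
- by rewrite invr_lt0.
- by rewrite [in LHS]q_real fmorphV.
- by rewrite [in LHS]mu_real fmorphV.
- exact: sqr_sqrtc.
Qed.
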